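(* Let $d\in\{1,2\}$, let $M,C,k,S$ be positive integers with $k$ odd, and let $N$ be a positive integer such that $SN\geq 2k-1$. For a convolutional layer defined using circular boundary conditions with kernel tensor $\mathbf{K}\in\mathbb{K}_d$, we have, both in the RO case ($M\le CS^d$) and in the CO case ($M\ge CS^d$), $$\left(\mathrm{err}^F_N(\mathbf{K})\right)^2=N^d\,L_{orth}(\mathbf{K}).$$
   Context: Write $k=2r+1$, and let $a\%n\in\{0,\dots,n-1\}$ denote the remainder of $a$ modulo $n$. Kernel tensors: $\mathbb{K}_1=\mathbb{R}^{M\times C\times k}$, $\mathbb{K}_2=\mathbb{R}^{M\times C\times k\times k}$; kernel spatial indices run from $0$ to $k-1$. Layer transform matrix (circular boundary conditions). For $d=1$, $\mathcal{K}\in\mathbb{R}^{MN\times CSN}$ is the matrix (after vectorization) of the linear map $X\in\mathbb{R}^{C\times SN}\mapsto Y\in\mathbb{R}^{M\times N}$, $$Y_{m,i}=\sum_{c=1}^C\sum_{i'=0}^{k-1}\mathbf{K}_{m,c,i'}X_{c,(i'+Si-r)\%SN},\quad 0\le i\le N-1.$$ For $d=2$, $\mathcal{K}\in\mathbb{R}^{MN^2\times CS^2N^2}$ is the matrix of $X\in\mathbb{R}^{C\times SN\times SN}\mapsto Y\in\mathbb{R}^{M\times N\times N}$, $$Y_{m,i,j}=\sum_{c=1}^C\sum_{i',j'=0}^{k-1}\mathbf{K}_{m,c,i',j'}X_{c,(i'+Si-r)\%SN,(j'+Sj-r)\%SN},\quad 0\le i,j\le N-1.$$ Orthogonality error: $\mathrm{err}^F_N(\mathbf{K})=\|\mathcal{K}\mathcal{K}^T-\mathrm{Id}_{MN^d}\|_F$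 in the RO case ($M\le CS^d$), and $\mathrm{err}^F_N(\mathbf{K})=\|\mathcal{K}^T\mathcal{K}-\mathrm{Id}_{CS^dN^d}\|_F$ in the CO case ($M\ge CS^d$), where $\|\cdot\|_F$ is the Frobenius norm (for a tensor of any order, the square root of the sum of squares of all entries). The function $L_{orth}$. Let $P=\lfloor\frac{k-1}{S}\rfloor S$. For $d=1$, let $\mathbf{T}\in\mathbb{R}^{M\times M\times(2P/S+1)}$ be $$\mathbf{T}_{m,l,i}=\sum_{c=1}^C\sum_{i'=0}^{k-1}\mathbf{K}_{m,c,i'}\,\mathbf{K}_{l,c,\,i'+Si-P},\quad 0\le i\le 2P/S,$$ and for $d=2$, let $\mathbf{T}\in\mathbb{R}^{M\times M\times(2P/S+1)\times(2P/S+1)}$ be $$\mathbf{T}_{m,l,i,j}=\sum_{c=1}^C\sum_{i',j'=0}^{k-1}\mathbf{K}_{m,c,i',j'}\,\mathbf{K}_{l,c,\,i'+Si-P,\,j'+Sj-P},\quad 0\le i,j\le 2P/S,$$ where entries of $\mathbf{K}$ with a spatial index outside $\{0,\dots,k-1\}$ are taken to be $0$ (zero padding). Let $\mathbf{I_{r0}}$ be the tensor of the same size as $\mathbf{T}$ all of whose entries are zero except its central $M\times M$ slice (spatial index $P/S$ if $d=1$, $(P/S,P/S)$ if $d=2$), which equals $\mathrm{Id}_M$. Then $$L_{orth}(\mathbf{K})=\|\mathbf{T}-\mathbf{I_{r0}}\|_F^2\ \text{ in the RO case},\qquad L_{orth}(\mathbf{K})=\|\mathbf{T}-\mathbf{I_{r0}}\|_F^2-(M-CS^d)\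 \text{ in the CO case}.$$ *)

(* Defs.v *)
From HB Require Import structures.
From mathcomp Require Import all_boot all_order all_algebra.
From mathcomp Require Import reals.

Set Implicit Arguments.
Unset Strict Implicit.
Unset Printing Implicit Defensive.

Import Order.TTheory GRing.Theory Num.Theory.
Local Open Scope ring_scope.

(* A real tensor with index set I (a product of ordinals) is
   an element of {ffun I -> R}; all indices start at 0. *)

Section Tensors.
Variable R : realType.

Definition frob (I : finType) (T : {ffun I -> R}) : R :=
  Num.sqrt (\sum_x T x ^+ 2).

Definition mxfrob (p q : nat) (A : 'M[R]_(p, q)) : R :=
  Num.sqrt (\sum_i \sum_j A i j ^+ 2).

(* The matrix of a linear map between tensor spaces: tensors are vectorized
   along the library's enumeration of their index set, and column b is the
   image of the b-th canonical basis tensor. *)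
Definition tensor_mx (I J : finType) (f : {ffun I -> R} -> {ffun J -> R}) :
    'M[R]_(#|J|, #|I|) :=
  \matrix_(a, b) f [ffun x => (x == enum_val b)%:R] (enum_val a).

(* Access at an arbitrary integer index: u z if 0 <= z < n, and 0 otherwise. *)
Definition zero_pad (n : nat) (u : 'I_n -> R) (z : int) : R :=
  if z is Posz a then oapp u 0 (insub a : option 'I_n) else 0.

(* u_(z % n): for n > 0 the remainder (z %% n)%Z lies in {0, .., n - 1}, so
   the zero default of zero_pad is never reached. *)
Definition circular (n : nat) (u : 'I_n -> R) (z : int) : R :=
  zero_pad u (z %% n%:Z)%Z.

End Tensors.

(* k = 2 r + 1 *)
Definition radius (k : nat) : nat := k./2.

Definition maxshift (k S : nat) : nat := ((k - 1) %/ S * S)%N.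

(* The spatial extent 2 P / S + 1 of T, where P = maxshift k S; the divisions
   by S are exact. *)
Definition extent (k S : nat) : nat := (2 * maxshift k S %/ S + 1)%N.

Definition center (k S : nat) : nat := (maxshift k S %/ S)%N.

Section Dim1.
Variables (R : realType) (M C k S N : nat).

Definition kernel1 := {ffun 'I_M * 'I_C * 'I_k -> R}.
Variable K : kernel1.

Definition conv1 (X : {ffun 'I_C * 'I_(S * N) -> R}) :
    {ffun 'I_M * 'I_N -> R} :=
  [ffun y : 'I_M * 'I_N => let: (m, i) := y in
    \sum_(c < C) \sum_(i' < k)
      K (m, c, i') *
      circular (fun a => X (c, a)) ((i' + S * i)%N%:Z - (radius k)%:Z)].

Definition layer1 := tensor_mx conv1.

Definition err1_RO : R := mxfrob (layer1 *m layer1^T - 1%:M).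
Definition err1_CO : R := mxfrob (layer1^T *m layer1 - 1%:M).

Definition T1 : {ffun 'I_M * 'I_M * 'I_(extent k S) -> R} :=
  [ffun y : 'I_M * 'I_M * 'I_(extent k S) => let: (m, l, i) := y in
    \sum_(c < C) \sum_(i' < k)
      K (m, c, i') *
      zero_pad (fun a => K (l, c, a))
        ((i' + S * i)%N%:Z - (maxshift k S)%:Z)].

Definition Ir0_1 : {ffun 'I_M * 'I_M * 'I_(extent k S) -> R} :=
  [ffun y : 'I_M * 'I_M * 'I_(extent k S) => let: (m, l, i) := y in
    ((i == center k S :> nat) && (m == l))%:R : R].

Definition Lorth1_RO : R := frob (T1 - Ir0_1) ^+ 2.
Definition Lorth1_CO : R :=
  frob (T1 - Ir0_1) ^+ 2 - (M%:R - (C * S)%N%:R).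

End Dim1.

Section Dim2.
Variables (R : realType) (M C k S N : nat).

Definition kernel2 := {ffun 'I_M * 'I_C * 'I_k * 'I_k -> R}.
Variable K : kernel2.

Definition conv2 (X : {ffun 'I_C * 'I_(S * N) * 'I_(S * N) -> R}) :
    {ffun 'I_M * 'I_N * 'I_N -> R} :=
  [ffun y : 'I_M * 'I_N * 'I_N => let: (m, i, j) := y in
    \sum_(c < C) \sum_(i' < k) \sum_(j' < k)
      K (m, c, i', j') *
      circular (fun a =>
        circular (fun b => X (c, a, b)) ((j' + S * j)%N%:Z - (radius k)%:Z))
        ((i' + S * i)%N%:Z - (radius k)%:Z)].

Definition layer2 := tensor_mx conv2.

Definition err2_RO : R := mxfrob (layer2 *m layer2^T - 1%:M).
Definition err2_CO : R := mxfrob (layer2^T *m layer2 - 1%:M).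

Definition T2 : {ffun 'I_M * 'I_M * 'I_(extent k S) * 'I_(extent k S) -> R} :=
  [ffun y : 'I_M * 'I_M * 'I_(extent k S) * 'I_(extent k S) =>
    let: (m, l, i, j) := y in
    \sum_(c < C) \sum_(i' < k) \sum_(j' < k)
      K (m, c, i', j') *
      zero_pad (fun a =>
        zero_pad (fun b => K (l, c, a, b))
          ((j' + S * j)%N%:Z - (maxshift k S)%:Z))
        ((i' + S * i)%N%:Z - (maxshift k S)%:Z)].

Definition Ir0_2 :
    {ffun 'I_M * 'I_M * 'I_(extent k S) * 'I_(extent k S) -> R} :=
  [ffun y : 'I_M * 'I_M * 'I_(extent k S) * 'I_(extent k S) =>
    let: (m, l, i, j) := y in
    ([&& i == center k S :> nat, j == center k S :> nat & m == l])%:R : R].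

Definition Lorth2_RO : R := frob (T2 - Ir0_2) ^+ 2.
Definition Lorth2_CO : R :=
  frob (T2 - Ir0_2) ^+ 2 - (M%:R - (C * S ^ 2)%N%:R).

End Dim2.

(* Main.v *)
(* A block entry of K K^T at output positions v, v' correlates two filters over
   the kernel positions u, u' with u + S v = u' + S v' modulo S N. As
   |u - u'| <= k - 1 and S N >= 2 k - 1, this congruence pins down u' - u to a
   single multiple of S in [-P, P], or has no solution. So every row of blocks
   of K K^T - Id lists the entries of T - I_r0 once each, padded with zeros, and
   summing over the N^d rows gives the RO case. Comparing the traces of
   (K K^T - Id)^2 and (K^T K - Id)^2 reduces the CO case to this one. *)
Require Import Defs.
From mathcomp Require Import all_boot all_order all_algebra.
From mathcomp Require Import reals.
From mathcomp Require Import zify ring.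

Set Implicit Arguments.
Unset Strict Implicit.
Unset Printing Implicit Defensive.

Import Order.TTheory GRing.Theory Num.Theory.
Local Open Scope ring_scope.

(** * Reindexing of finite sums *)

Lemma sum_pairA (V : nmodType) (I J : finType) (F : I * J -> V) :
  \sum_x F x = \sum_i \sum_j F (i, j).
Proof. by rewrite pair_bigA /=; apply: eq_bigr => -[]. Qed.

(** Grouping the last two indices lets a pair of spatial coordinates act as a single position when
    [d = 2]. *)
Lemma sum_tripleA (V : nmodType) (I J L : finType) (F : I * J * L -> V) :
  \sum_x F x = \sum_i \sum_(j : J * L) F (i, j.1, j.2).
Proof.
rewrite !sum_pairA; apply: eq_bigr => i _.
by rewrite sum_pairA.
Qed.

Lemma sum_enum_rank (V : nmodType) (I : finType) (F : 'I_#|I| -> V) :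
  \sum_a F a = \sum_x F (enum_rank x).
Proof. by rewrite (reindex enum_rank) //; apply: onW_bij; apply: enum_rank_bij. Qed.

Lemma sum_eqr (R : pzRingType) (I : finType) (i : I) (F : I -> R) :
  \sum_j F j * (j == i)%:R = F i.
Proof.
rewrite (bigD1 i) //= eqxx mulr1 big1 ?addr0 // => j /negPf ->.
by rewrite mulr0.
Qed.

(** * Frobenius norms and traces of Gram matrices *)

Section Norms.
Variable R : realType.

Lemma sqr_frob (I : finType) (T : {ffun I -> R}) :
  frob T ^+ 2 = \sum_x T x ^+ 2.
Proof. by rewrite sqr_sqrtr // sumr_ge0 // => x _; apply: sqr_ge0. Qed.

Lemma sqr_mxfrob p q (A : 'M[R]_(p, q)) :
  mxfrob A ^+ 2 = \sum_i \sum_j A i j ^+ 2.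
Proof.
rewrite sqr_sqrtr // sumr_ge0 // => i _; rewrite sumr_ge0 // => j _.
exact: sqr_ge0.
Qed.

Lemma sqr_mxfrob_trace p q (A : 'M[R]_(p, q)) :
  mxfrob A ^+ 2 = \tr (A *m A^T).
Proof.
rewrite sqr_mxfrob; apply: eq_bigr => i _; rewrite mxE.
by apply: eq_bigr => j _; rewrite mxE expr2.
Qed.

Lemma sqr_mxfrob_gram p q (A : 'M[R]_(p, q)) :
  mxfrob (A *m A^T - 1%:M) ^+ 2 =
  \tr (A *m A^T *m (A *m A^T)) - \tr (A *m A^T) *+ 2 + p%:R.
Proof.
rewrite sqr_mxfrob_trace linearB /= trmx_mul trmxK trmx1.
rewrite mulmxBl !mulmxBr !mulmx1 !mul1mx !raddfB /= mxtrace1.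
by ring.
Qed.

(** Expanded as traces, both errors have the same quartic and quadratic terms because the trace is
    cyclic; only the traces [p] and [q] of the two identity matrices differ. *)
Lemma sqr_mxfrob_gram_tr p q (A : 'M[R]_(p, q)) :
  mxfrob (A^T *m A - 1%:M) ^+ 2 =
  mxfrob (A *m A^T - 1%:M) ^+ 2 - (p%:R - q%:R).
Proof.
have := sqr_mxfrob_gram A^T; rewrite trmxK => ->; rewrite sqr_mxfrob_gram.
rewrite -[A^T *m A *m _]mulmxA [\tr (A^T *m (_ *m _))]mxtrace_mulC.
rewrite [\tr (A^T *m A)]mxtrace_mulC !mulmxA; ring.
Qed.

Lemma sqr_mxfrob_gram_tensor (I J : finType)
    (f : {ffun I -> R} -> {ffun J -> R}) :
  mxfrob (tensor_mx f *m (tensor_mx f)^T - 1%:M) ^+ 2 =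
  \sum_x \sum_y (\sum_z f [ffun t => (t == z)%:R] x *
                        f [ffun t => (t == z)%:R] y - (x == y)%:R) ^+ 2.
Proof.
rewrite sqr_mxfrob sum_enum_rank; apply: eq_bigr => x _.
rewrite sum_enum_rank; apply: eq_bigr => y _.
rewrite !mxE (inj_eq enum_rank_inj) sum_enum_rank.
by under eq_bigr do rewrite !mxE !enum_rankK.
Qed.

End Norms.

(* Both dimensions at once: [pos u v] is the input cell read by kernel cell [u]
   for output [v], [shift u d u'] says that u' is u translated by the offset [d],
   and [move v d] is the only output whose window can realize that offset. *)
Section AbstractConvolution.
Variables (R : comPzRingType) (M C : nat) (U V W D : finType).
Variables (pos : U -> V -> W) (shift : U -> D -> pred U).
Variables (move : V -> D -> V) (d0 : D).
Hypothesis move_inj : forall v, injective (move v).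
Hypothesis move0 : forall v, move v d0 = v.
Hypothesis pos_move :
  forall u u' v d, (pos u v == pos u' (move v d)) = shift u d u'.
Hypothesis pos_eq :
  forall u u' v v', pos u v = pos u' v' -> exists d, v' = move v d.
Variable K : 'I_M -> 'I_C -> U -> R.

Let entry m v c w : R := \sum_u K m c u * (pos u v == w)%:R.

(** Summing over the input cell [w] first merges the two indicators into the condition that both
    windows read the same cell. *)
Lemma gram_entry m v l v' :
  \sum_c \sum_w entry m v c w * entry l v' c w =
  \sum_c \sum_u \sum_u' K m c u * (K l c u' * (pos u v == pos u' v')%:R).
Proof.
apply: eq_bigr => c _.
under eq_bigr => w _ do rewrite /entry mulr_suml.
rewrite exchange_big /=; apply: eq_bigr => u _.
under eq_bigr => w _ do rewrite mulr_sumr.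
rewrite exchange_big /=; apply: eq_bigr => u' _.
rewrite -(sum_eqr (pos u v) (fun w => K m c u * (K l c u' * (w == pos u' v')%:R))).
by apply: eq_bigr => w _; rewrite (eq_sym w) (eq_sym w); ring.
Qed.

(** For fixed [v], the offsets [d] index injectively, through [move v], every output [v'] whose
    window can meet that of [v]. The resulting sum over [d] does not depend on [v], whence the
    factor [#|V|]. *)
Lemma gram_error_shift :
  \sum_m \sum_v \sum_l \sum_v'
    (\sum_c \sum_w entry m v c w * entry l v' c w
      - ((m == l) && (v == v'))%:R) ^+ 2 =
  #|V|%:R * \sum_m \sum_l \sum_d
    (\sum_c \sum_u \sum_u' K m c u * (K l c u' * (shift u d u')%:R)
      - ((d == d0) && (m == l))%:R) ^+ 2.
Proof.
rewrite exchange_big /= mulr_natl -sumr_const; apply: eq_bigr => v _.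
apply: eq_bigr => m _; apply: eq_bigr => l _.
(* Outside the image of [move v] the Gram entry vanishes, and so does the identity entry, since
   [v = move v d0] lies in the image. *)
rewrite (bigID (mem (codom (move v)))) /= [X in _ + X]big1 ?addr0; last first.
  move=> v' v'P; rewrite gram_entry big1 => [|c _]; last first.
    apply: big1 => u _; apply: big1 => u' _.
    case: eqP => [/pos_eq[d def_v']|_]; last by rewrite !mulr0.
    by rewrite def_v' codom_f in v'P.
  case: (v =P v') => [def_v|_]; last by rewrite andbF subr0 expr0n.
  by rewrite -def_v -[X in X \in _](move0 v) codom_f in v'P.
rewrite (eq_bigl (mem [set move v d | d in D])); last first.
  by move=> v'; apply/codomP/imsetP => [[d ->]|[d _ ->]]; exists d.
rewrite big_imset /=; last by move=> d d' _ _; apply: move_inj.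
apply: eq_bigr => d _; rewrite gram_entry.
have -> : (v == move v d) = (d == d0).
  by rewrite -[X in X == _](move0 v) (inj_eq (@move_inj v)) eq_sym.
rewrite andbC.
congr ((_ - _) ^+ 2); apply: eq_bigr => c _; apply: eq_bigr => u _.
by apply: eq_bigr => u' _; rewrite pos_move.
Qed.

End AbstractConvolution.

(** * Arithmetic of positions modulo [S * N] *)

Lemma dvdz_small (n a : int) : (n %| a)%Z -> `|a| < n -> a = 0.
Proof.
move=> n_a a_lt; apply/eqP; rewrite -absz_eq0 -leqn0 leqNgt; apply/negP => a_gt0.
by have := dvdn_leq a_gt0 n_a; lia.
Qed.

Section Geometry.
Variables k S N : nat.
Hypotheses (k_gt0 : (0 < k)%N) (S_gt0 : (0 < S)%N) (N_gt0 : (0 < N)%N).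
Hypothesis hSN : (2 * k - 1 <= S * N)%N.

Definition rem_ord n (n_gt0 : (0 < n)%N) (z : int) : 'I_n :=
  Ordinal (ltn_pmod `|(z %% n%:Z)%Z| n_gt0).

Lemma rem_ordE n (n_gt0 : (0 < n)%N) z :
  (rem_ord n_gt0 z)%:Z = (z %% n%:Z)%Z.
Proof.
have n_pos : 0 < n%:Z by lia.
have := ltz_pmod z n_pos; have := @modz_ge0 z n%:Z ltac:(lia).
by rewrite /=; case: (z %% n%:Z)%Z => // a _ a_lt; rewrite modn_small.
Qed.

Lemma circularE (R : realType) n (n_gt0 : (0 < n)%N) (u : 'I_n -> R) z :
  circular u z = u (rem_ord n_gt0 z).
Proof.
rewrite /circular -rem_ordE /=; case: insubP => [a _ def_a|].
  by congr u; apply: val_inj.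
by rewrite ltn_pmod.
Qed.

(** As a sum of indicators, zero padding takes the form of the [shift] condition of the abstract
    convolution. *)
Lemma zero_padE (R : realType) n (u : 'I_n -> R) z :
  zero_pad u z = \sum_a u a * (a%:Z == z)%:R.
Proof.
case: z => a; last by rewrite big1 // => b _; rewrite mulr0.
rewrite /=; case: insubP => [b _ <-|a_ge] /=; first by rewrite -(sum_eqr b).
rewrite big1 // => b _; case: eqP => [[ab]|_]; last by rewrite mulr0.
by rewrite -ab ltn_ord in a_ge.
Qed.

Let SN_gt0 : (0 < S * N)%N. Proof. by rewrite muln_gt0 S_gt0. Qed.

Definition position (u : 'I_k) (v : 'I_N) : 'I_(S * N) :=
  rem_ord SN_gt0 ((u + S * v)%N%:Z - (radius k)%:Z).

Definition kernel_shift (u : 'I_k) (d : 'I_(extent k S)) : pred 'I_k :=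
  fun u' => u'%:Z == (u + S * d)%N%:Z - (maxshift k S)%:Z.

(** Solves [u + S v = u' + S v'] for [v'] when [u' = u + S d - P], with [P = S * center k S]. *)
Definition output_move (v : 'I_N) (d : 'I_(extent k S)) : 'I_N :=
  rem_ord N_gt0 (v%:Z - d%:Z + (center k S)%:Z).

Lemma maxshiftE : maxshift k S = (S * center k S)%N.
Proof. by rewrite /center /maxshift mulnK // mulnC. Qed.

Lemma extentE : extent k S = (2 * center k S).+1.
Proof. by rewrite /extent /center /maxshift mulnA !mulnK // addn1. Qed.

Lemma maxshift_le : (maxshift k S <= k - 1)%N.
Proof. exact: leq_trunc_div. Qed.

(** From [2 P <= 2 k - 2 < S N], division by [S] gives [2 * center k S < N]. Hence distinct offsets
    stay distinct modulo [N]. *)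
Lemma extent_le : (extent k S <= N)%N.
Proof.
have := maxshift_le; rewrite maxshiftE extentE -(ltn_pmul2l S_gt0) => ?; nia.
Qed.

Lemma center_lt : (center k S < extent k S)%N.
Proof. rewrite extentE; lia. Qed.

Lemma position_eq (u u' : 'I_k) (v v' : 'I_N) :
  (position u v == position u' v') =
  ((S * N)%N%:Z %| u%:Z - u'%:Z + S%:Z * (v%:Z - v'%:Z))%Z.
Proof.
rewrite -val_eqE -eqz_nat !rem_ordE eqz_mod_dvd; congr (_ %| _)%Z; lia.
Qed.

Lemma output_move_inj v : injective (output_move v).
Proof.
move=> d d' /(congr1 (fun v : 'I_N => v%:Z)); rewrite !rem_ordE => /eqP.
rewrite eqz_mod_dvd => /dvdz_small dd'; apply: val_inj => /=.
have := extent_le; have := ltn_ord d; have := ltn_ord d'; lia.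
Qed.

Lemma output_move_center v : output_move v (Ordinal center_lt) = v.
Proof.
apply: val_inj; apply/eqP; rewrite -eqz_nat rem_ordE /= subrK.
by rewrite modz_small //= ltz_nat ltn_ord.
Qed.

Lemma position_move u u' v d :
  (position u v == position u' (output_move v d)) = kernel_shift u d u'.
Proof.
rewrite position_eq rem_ordE /kernel_shift maxshiftE.
have := maxshift_le; rewrite maxshiftE => Pk.
(* Here [q] counts the turns made when [output_move] wraps around modulo [N]; each turn adds one
   multiple of [S * N]. *)
set z := v%:Z - _ + _; have := divz_eq z N; set q := (z %/ _)%Z => def_z.
have -> : u%:Z - u'%:Z + S%:Z * (v%:Z - (z %% N)%Z) =
    (u%:Z - u'%:Z + S%:Z * d%:Z - (S * center k S)%N%:Z) + q * (S * N)%N%:Z.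
  have -> : (z %% N)%Z = z - q * N by rewrite {2}def_z; ring.
  by rewrite /z; lia.
have [u_lt u'_lt] := (ltn_ord u, ltn_ord u').
have := ltn_ord d; rewrite [X in (_ < X)%N]extentE => d_lt.
have Sd_le : (S * d <= 2 * (S * center k S))%N by nia.
apply/idP/eqP => [/dvdzP[p def_p]|def_u']; last first.
  by apply/dvdzP; exists q; lia.
suff : u%:Z - u'%:Z + S%:Z * d%:Z - (S * center k S)%N%:Z = 0 by lia.
(* Both [u - u'] and [S d - P] are at most [k - 1] in absolute value, so their sum stays below
   [2 k - 1 <= S N]. *)
apply: (@dvdz_small (S * N)%N%:Z); last by lia.
by apply/dvdzP; exists (p - q); rewrite mulrBl -def_p addrK.
Qed.

Lemma position_eq_move u u' v v' :
  position u v = position u' v' -> exists d, v' = output_move v d.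
Proof.
move/eqP; rewrite position_eq => /dvdzP[q def_q].
(* The congruence forces [u' - u] to be the multiple [S e] of the stride. *)
pose e : int := v%:Z - v'%:Z - q * N%:Z.
have def_u : u'%:Z - u%:Z = S%:Z * e by rewrite /e; lia.
have [u_lt u'_lt] := (ltn_ord u, ltn_ord u').
(* [center k S] is the floor of [(k - 1) / S], so [|S e| <= k - 1] bounds [|e|] by it. *)
have center_max (a : nat) : (S * a <= k - 1)%N -> (a <= center k S)%N.
  by rewrite /center mulnK // leq_divRL // mulnC.
have e_le : e <= center k S.
  case: (leP e 0) => [|e_gt0]; first lia.
  have := center_max (absz e); nia.
have e_ge : - (center k S)%:Z <= e.
  case: (leP 0 e) => [|e_lt0]; first lia.
  have := center_max (absz e); nia.
(* Offsets are stored from 0, so the signed shift [e] is recentred. *)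
pose d : int := e + (center k S)%:Z.
have d_lt : (absz d < extent k S)%N by rewrite extentE /d; lia.
exists (Ordinal d_lt); apply: val_inj; apply/eqP; rewrite -eqz_nat rem_ordE /=.
have -> : v%:Z - (absz d)%:Z + (center k S)%:Z = q * N + v'.
  by rewrite /d /e; lia.
by rewrite modzMDl modz_small //= ltz_nat ltn_ord.
Qed.

(** * The layers in dimensions one and two *)

Section Layers.

Variables (R : realType) (M C : nat).

Lemma conv1_basis (K : kernel1 R M C k) m v c w :
  conv1 K [ffun x : 'I_C * 'I_(S * N) => (x == (c, w))%:R] (m, v) =
  \sum_u K (m, c, u) * (position u v == w)%:R.
Proof.
rewrite ffunE -(sum_eqr c (fun c => \sum_u K (m, c, u) * _)).
apply: eq_bigr => c' _; rewrite mulr_suml; apply: eq_bigr => u _.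
by rewrite circularE ffunE xpair_eqE -mulrA -natrM mulnb andbC.
Qed.

Lemma T1E (K : kernel1 R M C k) m l d :
  T1 S K (m, l, d) =
  \sum_c \sum_u \sum_u' K (m, c, u) *
    (K (l, c, u') * (kernel_shift u d u')%:R).
Proof.
rewrite ffunE; apply: eq_bigr => c _; apply: eq_bigr => u _.
by rewrite zero_padE mulr_sumr.
Qed.

Lemma err1_ROE (K : kernel1 R M C k) :
  err1_RO S N K ^+ 2 = N%:R * Lorth1_RO S K.
Proof.
rewrite /err1_RO sqr_mxfrob_gram_tensor /Lorth1_RO sqr_frob.
have := gram_error_shift output_move_inj output_move_center position_move
  position_eq_move (fun m c u => K (m, c, u)).
rewrite card_ord => eq_gram.
rewrite sum_pairA; under eq_bigr do under eq_bigr do rewrite sum_pairA.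
(* The abstract identity is the middle link; the outer two identify its sides with the matrix error
   and with [T - I_r0]. *)
etransitivity; last etransitivity; [|exact: eq_gram|].
- apply: eq_bigr => m _; apply: eq_bigr => v _.
  apply: eq_bigr => l _; apply: eq_bigr => v' _.
  rewrite sum_pairA xpair_eqE; congr ((_ - _) ^+ 2).
  by apply: eq_bigr => c _; apply: eq_bigr => w _; rewrite !conv1_basis.
- congr (_ * _); rewrite !sum_pairA.
  apply: eq_bigr => m _; apply: eq_bigr => l _; apply: eq_bigr => d _.
  by rewrite [(T1 S K - _) _]ffunE [(- _ : {ffun _}) _]ffunE T1E [Ir0_1 _ _ _ _ _]ffunE.
Qed.

(** The planar geometry is the square of the linear one, so each hypothesis of the abstract
    convolution follows coordinatewise. *)
Definition position2 (u : 'I_k * 'I_k) (v : 'I_N * 'I_N) :=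
  (position u.1 v.1, position u.2 v.2).

Definition kernel_shift2 (u : 'I_k * 'I_k)
    (d : 'I_(extent k S) * 'I_(extent k S)) : pred ('I_k * 'I_k) :=
  fun u' => kernel_shift u.1 d.1 u'.1 && kernel_shift u.2 d.2 u'.2.

Definition output_move2 (v : 'I_N * 'I_N)
    (d : 'I_(extent k S) * 'I_(extent k S)) : 'I_N * 'I_N :=
  (output_move v.1 d.1, output_move v.2 d.2).

Lemma output_move2_inj v : injective (output_move2 v).
Proof.
move=> [d1 d2] [e1 e2] /eqP; rewrite xpair_eqE.
by rewrite !(inj_eq (@output_move_inj _)) => /andP[/eqP /= -> /eqP /= ->].
Qed.

Lemma output_move2_center v :
  output_move2 v (Ordinal center_lt, Ordinal center_lt) = v.
Proof. by case: v => v1 v2; rewrite /output_move2 !output_move_center. Qed.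

Lemma position2_move u u' v d :
  (position2 u v == position2 u' (output_move2 v d)) = kernel_shift2 u d u'.
Proof. by rewrite xpair_eqE !position_move. Qed.

Lemma position2_eq_move u u' v v' :
  position2 u v = position2 u' v' -> exists d, v' = output_move2 v d.
Proof.
case: v' => v1 v2 /eqP; rewrite xpair_eqE.
case/andP=> /eqP/position_eq_move[d1 /= ->] /eqP/position_eq_move[d2 /= ->].
by exists (d1, d2).
Qed.

Lemma conv2_basis (K : kernel2 R M C k) m v c w :
  conv2 K [ffun x : 'I_C * 'I_(S * N) * 'I_(S * N) => (x == (c, w.1, w.2))%:R]
    (m, v.1, v.2) =
  \sum_u K (m, c, u.1, u.2) * (position2 u v == w)%:R.
Proof.
rewrite ffunE -(sum_eqr c (fun c => \sum_u K (m, c, u.1, u.2) * _)).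
apply: eq_bigr => c' _; rewrite mulr_suml sum_pairA.
apply: eq_bigr => u1 _; apply: eq_bigr => u2 _; case: w => w1 w2.
by rewrite !circularE ffunE !xpair_eqE -mulrA -natrM mulnb [in RHS]andbC andbA.
Qed.

Lemma T2E (K : kernel2 R M C k) m l d :
  T2 S K (m, l, d.1, d.2) =
  \sum_c \sum_u \sum_u' K (m, c, u.1, u.2) *
    (K (l, c, u'.1, u'.2) * (kernel_shift2 u d u')%:R).
Proof.
rewrite ffunE; apply: eq_bigr => c _; rewrite sum_pairA.
apply: eq_bigr => u1 _; apply: eq_bigr => u2 _.
rewrite zero_padE mulr_sumr sum_pairA; apply: eq_bigr => u1' _.
rewrite zero_padE mulr_suml mulr_sumr; apply: eq_bigr => u2' _.
by rewrite -mulrA -natrM mulnb andbC.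
Qed.

Lemma err2_ROE (K : kernel2 R M C k) :
  err2_RO S N K ^+ 2 = N%:R ^+ 2 * Lorth2_RO S K.
Proof.
rewrite /err2_RO sqr_mxfrob_gram_tensor /Lorth2_RO sqr_frob.
have := gram_error_shift output_move2_inj output_move2_center position2_move
  position2_eq_move (fun m c u => K (m, c, u.1, u.2)).
rewrite card_prod card_ord natrM -expr2 => eq_gram.
rewrite sum_tripleA; under eq_bigr do under eq_bigr do rewrite sum_tripleA.
etransitivity; last etransitivity; [|exact: eq_gram|].
- apply: eq_bigr => m _; apply: eq_bigr => v _.
  apply: eq_bigr => l _; apply: eq_bigr => v' _.
  rewrite sum_tripleA !xpair_eqE -andbA; congr ((_ - _) ^+ 2).
    by apply: eq_bigr => c _; apply: eq_bigr => w _; rewrite !conv2_basis.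
- congr (_ * _); rewrite sum_tripleA sum_pairA.
  apply: eq_bigr => m _; apply: eq_bigr => l _; apply: eq_bigr => d _.
  rewrite [(T2 S K - _) _]ffunE [(- _ : {ffun _}) _]ffunE T2E.
  by rewrite [Ir0_2 _ _ _ _ _]ffunE andbA; case: d.
Qed.

End Layers.

End Geometry.

Theorem theorem7 (R : realType) (M C k S N : nat)
    (M_gt0 : (0 < M)%N) (C_gt0 : (0 < C)%N) (k_gt0 : (0 < k)%N)
    (S_gt0 : (0 < S)%N) (N_gt0 : (0 < N)%N)
    (k_odd : odd k) (hSN : (2 * k - 1 <= S * N)%N) :
  (* d = 1 *)
  (forall K : kernel1 R M C k,
     ((M <= C * S)%N -> err1_RO S N K ^+ 2 = N%:R * Lorth1_RO S K) /\
     ((C * S <= M)%N -> err1_CO S N K ^+ 2 = N%:R * Lorth1_CO S K)) /\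
  (* d = 2 *)
  (forall K : kernel2 R M C k,
     ((M <= C * S ^ 2)%N -> err2_RO S N K ^+ 2 = N%:R ^+ 2 * Lorth2_RO S K) /\
     ((C * S ^ 2 <= M)%N -> err2_CO S N K ^+ 2 = N%:R ^+ 2 * Lorth2_CO S K)).
Proof.
have err1 := @err1_ROE k S N k_gt0 S_gt0 N_gt0 hSN R M C.
have err2 := @err2_ROE k S N k_gt0 S_gt0 N_gt0 hSN R M C.
split=> K; split=> _ //.
  rewrite /err1_CO sqr_mxfrob_gram_tr -/(err1_RO S N K) err1.
  (* The sizes of the two identity matrices differ by [M N - C S N = N (M - C S)], which is [N]
     times the correction in the CO loss. *)
  by rewrite /Lorth1_CO /Lorth1_RO !card_prod !card_ord !natrM; ring.
rewrite /err2_CO sqr_mxfrob_gram_tr -/(err2_RO S N K) err2.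
by rewrite /Lorth2_CO /Lorth2_RO !card_prod !card_ord !natrM; ring.
Qed.
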